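(* Let $w:\mathbb N\to(0,\infty)$ be a weight function. The eigenvalues of the biased one-sided transposition shuffle $\mathrm{OST}_{n,w}$ on $n$ cards are indexed by standard Young tableaux of size $n$. Moreover, the eigenvalue corresponding to a tableau $T$ is given by $$\mathrm{eig}(T)=\frac{1}{N_w(n)}\sum_{(i,j)\in T}\frac{j-i+1}{T(i,j)}\cdot w\bigl(T(i,j)\bigr),$$ where the sum is over all boxes $(i,j)$ of $T$.
   Context: For a weight function $w:\mathbb N\to(0,\infty)$ let $N_w(n)=\sum_{k=1}^n w(k)$. The biased one-sided transposition shuffle $\mathrm{OST}_{n,w}$ is the random walk on $S_n$ driven by the distribution $\mathrm{OST}_{n,w}((i\,j))=\frac{w(j)}{N_w(n)}\cdot\frac1j$ for $1\le i\le j\le n$ (each $(i\,i)$ being the identity, so the masses for $i=j$ add up on the identity), and $0$ elsewhere. Its eigenvalues are those of the transition matrix $P(g,h)=\mathrm{OST}_{n,w}(hg^{-1})$, $g,h\in S_n$. A standard Young tableau $T$ of size $n$ is a filling of the Young diagram of some partition of $n$ by $1,\dots,n$, each used once, increasing along rows and down columns; box $(i,j)$ is in row $i$ and column $j$ and $T(i,j)$ is its entry. *)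

(* Defs.v *)
From HB Require Import structures.
From mathcomp Require Import all_boot all_order all_algebra all_fingroup.
From mathcomp Require Import reals.
From mathcomp Require Import complex.

Set Implicit Arguments.
Unset Strict Implicit.
Unset Printing Implicit Defensive.

Import Order.TTheory GRing.Theory Num.Theory.

Local Open Scope ring_scope.

Definition weight_sum (R : realType) (w : nat -> R) (n : nat) : R :=
  \sum_(1 <= k < n.+1) w k.

(* The card labelled k in {1, ..., n} is the ordinal k.-1 : 'I_n, so the       *)
(* transposition (i j) of the labels i.+1 <= j.+1 is tperm i j. As             *)
(* tperm i i = 1, the masses of the pairs (i, i) add up on the identity.       *)
Definition OST (R : realType) (w : nat -> R) (n : nat) (g : 'S_n) : R :=
  \sum_(j < n) \sum_(i < n | (i <= j)%N && (tperm i j == g))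
    w j.+1 / weight_sum w n * (j.+1%:R)^-1.

(* MathComp multiplies permutations from left to right. Since OST w g^-1 and   *)
(* OST w g are equal, relabelling the states by g |-> g^-1 turns this matrix   *)
(* into the one for the right-to-left product.                                 *)
Definition OST_mx (R : realType) (w : nat -> R) (n : nat) :
    'M[R]_#|{: 'S_n}| :=
  \matrix_(a, b) OST w ((enum_val b : 'S_n) * (enum_val a : 'S_n)^-1)%g.

(* A tableau is the list of its rows, read from the top; rows and columns are  *)
(* counted from 0, so the box (i, j) of the usual convention is (i.-1, j.-1)   *)
(* and j - i is unaffected.                                                    *)
Definition tab_row (T : seq (seq nat)) (i : nat) : seq nat := nth [::] T i.

Definition tab_entry (T : seq (seq nat)) (i j : nat) : nat :=
  nth 0%N (tab_row T i) j.

Definition is_partition (la : seq nat) : bool :=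
  sorted geq la && (0%N \notin la).

(* The entry condition also makes the shape a partition of n.                  *)
Record standard_tableau (n : nat) : Type := StandardTableau {
  tab_rows :> seq (seq nat);
  tab_shape : is_partition (map size tab_rows);
  tab_content : perm_eq (flatten tab_rows) (iota 1 n);
  tab_rows_incr : forall i j : nat,
    (j.+1 < size (tab_row tab_rows i))%N ->
    (tab_entry tab_rows i j < tab_entry tab_rows i j.+1)%N;
  tab_cols_incr : forall i j : nat,
    (j < size (tab_row tab_rows i.+1))%N ->
    (tab_entry tab_rows i j < tab_entry tab_rows i.+1 j)%N
}.

Definition eig (R : realType) (w : nat -> R) (n : nat)
    (T : standard_tableau n) : R :=
  (weight_sum w n)^-1 *
  \sum_(i < size T) \sum_(j < size (tab_row T i))
    (j%:R - i%:R + 1) / (tab_entry T i j)%:R * w (tab_entry T i j).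

(* Main.v *)
(* Write J_k for the sum of the transpositions (i k) with i < k (the
   Jucys-Murphy elements).  The transition matrix is the linear combination of
   the commuting matrices 1 + J_k with coefficients w(k) / (N_w(n) k), so its
   eigenvalues are read off from the joint spectrum of the J_k on the regular
   representation, which consists of the content vectors of standard tableaux.
   One inclusion is the Okounkov-Vershik argument: the relation
   J_(k+1) s_k = s_k J_k + 1 and the self-adjointness of the J_k constrain which
   entries of a joint weight may be adjacent and allow all other adjacent
   entries to be exchanged.  For the other inclusion, such exchanges reduce a
   tableau to the one that is filled column by column, whose content vector is
   the joint weight of the Specht polynomial F: if k sits in box (i, j), counted
   from (0, 0), then J_k F = (j - i) F, because the i transpositions within the
   column of k negate F and, by Lagrange interpolation, the transpositions into
   each of the j earlier columns sum up to F. *)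
Require Import Defs.
From mathcomp Require Import all_boot all_order all_algebra all_fingroup.
From mathcomp Require Import spectral.
From mathcomp Require Import zify ring.
From mathcomp Require Import reals.
From mathcomp Require Import complex.

Set Implicit Arguments.
Unset Strict Implicit.
Unset Printing Implicit Defensive.

Import Order.TTheory GRing.Theory Num.Theory.

Local Open Scope ring_scope.

(** * Jucys-Murphy elements *)

Section JucysMurphy.

Variables (n : nat) (F : comNzRingType).

(** Row vectors are functions v on the group, and [lreg_mx g] sends v to the function h |-> v(gh);
    with this convention g |-> [lreg_mx g] is multiplicative. *)
Definition lreg_mx (g : 'S_n) : 'M[F]_#|{: 'S_n}| :=
  \matrix_(a, b) (enum_val a == g * enum_val b)%g%:R.

Definition jm_mx (k : 'I_n) : 'M[F]_#|{: 'S_n}| :=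
  \sum_(i < n | (i < k)%N) lreg_mx (tperm i k).

Lemma lreg_mxE (v : 'rV_#|{: 'S_n}|) g b :
  (v *m lreg_mx g) 0 b = v 0 (enum_rank (g * enum_val b)%g).
Proof.
rewrite mxE (bigD1 (enum_rank (g * enum_val b)%g)) //= mxE enum_rankK eqxx mulr1.
rewrite big1 ?addr0 // => a; rewrite mxE -[in X in X -> _](inj_eq enum_val_inj).
by rewrite enum_rankK => /negbTE->; rewrite mulr0.
Qed.

Lemma lreg_mxM g h : lreg_mx g *m lreg_mx h = lreg_mx (g * h)%g.
Proof.
apply/row_matrixP => a; rewrite row_mul; apply/rowP => b.
by rewrite lreg_mxE !mxE enum_rankK mulgA.
Qed.

Lemma lreg_mx1 : lreg_mx 1%g = 1%:M.
Proof. by apply/matrixP => a b; rewrite !mxE mul1g (inj_eq enum_val_inj). Qed.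

Lemma trmx_lreg g : (lreg_mx g)^T = lreg_mx g^-1%g.
Proof.
apply/matrixP => a b; rewrite !mxE; congr ((nat_of_bool _)%:R).
by apply/eqP/eqP => ->; rewrite ?mulKg ?mulKVg.
Qed.

Lemma lreg_mx_tpermK (i j : 'I_n) :
  lreg_mx (tperm i j) *m lreg_mx (tperm i j) = 1%:M.
Proof. by rewrite lreg_mxM tperm2 lreg_mx1. Qed.

(** Conjugation by g permutes the transpositions (i k), i < k, and so fixes their sum. *)
Lemma comm_lreg_jm (g : 'S_n) (k : 'I_n) :
    g k = k -> (forall i : 'I_n, (i < k)%N -> (g i < k)%N) ->
  comm_mx (lreg_mx g) (jm_mx k).
Proof.
move=> gk gP; have gPE (i : 'I_n) : (g i < k)%N = (i < k)%N.
  (* As g has finite order, its inverse is one of its powers, so g permutes the indices below k. *)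
  have giter m (j : 'I_n) : (j < k)%N -> ((g ^+ m)%g j < k)%N.
    elim: m j => [|m IH] j jk; first by rewrite expg0 perm1.
    by rewrite expgS permM IH // gP.
  apply/idP/idP => [|/gP//] /(giter #[g]%g.-1); rewrite -permM -expgS prednK //.
  by rewrite expg_order perm1.
rewrite /comm_mx mulmx_sumr mulmx_suml [LHS](reindex_inj (@perm_inj _ g)) /=.
apply: eq_big => [i|i _]; first by rewrite gPE.
rewrite !lreg_mxM; congr lreg_mx.
by rewrite -{1}gk -tpermJ conjgE mulKVg.
Qed.

(** For k < l, every transposition in J_k moves only indices below l and so commutes with J_l. *)
Lemma comm_jm (k l : 'I_n) : comm_mx (jm_mx k) (jm_mx l).
Proof.
wlog: k l / (k < l)%N => [W|kl].
  case: (ltngtP k l) => [/W//|/W/comm_mx_sym//|/val_inj->].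
  exact: comm_mx_refl.
rewrite /comm_mx mulmx_suml {1}/jm_mx mulmx_sumr; apply: eq_bigr => i ik.
have il : (i < l)%N by apply: ltn_trans kl.
apply: comm_lreg_jm => [|j jl].
  by rewrite tpermD // -val_eqE /= ltn_eqF.
by case: tpermP => // _.
Qed.

(** Conjugation by (i j) turns each (a i) into (a j); the one summand of J_j not reached is (i j)
    itself. *)
Lemma jm_mxS (i j : 'I_n) : j = i.+1 :> nat ->
  jm_mx j = lreg_mx (tperm i j) *m jm_mx i *m lreg_mx (tperm i j)
            + lreg_mx (tperm i j).
Proof.
move=> ji; rewrite /(jm_mx j) (bigD1 i) ?ji //= addrC; congr (_ + _).
rewrite mulmx_sumr mulmx_suml; apply: eq_big => [a|a ai].
  by rewrite -val_eqE /=; lia.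
rewrite !lreg_mxM; congr lreg_mx.
have := tpermJ a i (tperm i j); rewrite conjgE tpermV mulgA => ->.
by case/andP: ai; rewrite -val_eqE /= => *; rewrite tpermL tpermD // -val_eqE /=; lia.
Qed.

End JucysMurphy.

(** * Joint weights of the Jucys-Murphy elements and exchange of adjacent entries *)

Section JointSpectrum.

Variables (n : nat) (C : numClosedFieldType).
Local Notation N := #|{: 'S_n}|.
Implicit Types (v : 'rV[C]_N) (s : seq C).

Definition jm_spec s : Prop :=
  size s = n /\ exists2 v : 'rV[C]_N, v != 0 & forall k : 'I_n, v *m jm_mx C k = s`_k *: v.

Definition rdot v1 v2 : C := (v1 *m (map_mx Num.conj v2)^T) 0 0.

Lemma rdotvv_eq0 v : rdot v v = 0 -> v = 0.
Proof.
have vv i : v 0 i * ((map_mx Num.conj v)^T) i 0 = `|v 0 i| ^+ 2.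
  by rewrite !mxE normCK.
rewrite /rdot mxE (eq_bigr _ (fun i _ => vv i)) => /psumr_eq0P H.
apply/rowP => i; rewrite mxE; apply/eqP; rewrite -normr_eq0 -sqrf_eq0 H // => j _.
exact: exprn_ge0.
Qed.

Lemma rdotDl v1 v2 v3 : rdot (v1 + v2) v3 = rdot v1 v3 + rdot v2 v3.
Proof. by rewrite /rdot mulmxDl mxE. Qed.

Lemma rdotZl a v1 v2 : rdot (a *: v1) v2 = a * rdot v1 v2.
Proof. by rewrite /rdot -scalemxAl mxE. Qed.

Lemma rdotC v1 v2 : rdot v1 v2 = (rdot v2 v1)^*.
Proof.
rewrite /rdot !mxE rmorph_sum; apply: eq_bigr => i _.
by rewrite !mxE rmorphM /= conjCK mulrC.
Qed.

Lemma rdotZr a v1 v2 : rdot v1 (a *: v2) = a^* * rdot v1 v2.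
Proof. by rewrite rdotC rdotZl rmorphM /= -rdotC. Qed.

Lemma rdot_lreg v1 v2 (g : 'S_n) :
  rdot (v1 *m lreg_mx C g) v2 = rdot v1 (v2 *m lreg_mx C g^-1%g).
Proof.
rewrite /rdot map_mxM trmx_mul mulmxA; congr ((_ *m _ *m _) _ _).
by rewrite map_trmx trmx_lreg invgK; apply/matrixP => a b; rewrite !mxE rmorph_nat.
Qed.

Lemma rdot_jm v1 v2 k : rdot (v1 *m jm_mx C k) v2 = rdot v1 (v2 *m jm_mx C k).
Proof.
have rdot_suml u w (P : pred 'I_n) (A : 'I_n -> 'M[C]_N) :
    rdot (u *m (\sum_(i | P i) A i)) w = \sum_(i | P i) rdot (u *m A i) w.
  by rewrite mulmx_sumr /rdot mulmx_suml summxE.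
rewrite [RHS]rdotC !rdot_suml rmorph_sum; apply: eq_bigr => i _.
by rewrite rdot_lreg tpermV; apply: rdotC.
Qed.

Lemma jm_spec_real s k : jm_spec s -> s`_k \is Num.real.
Proof.
case=> ss [v v0 vJ]; case: (ltnP k n) => kn; last by rewrite nth_default ?ss // real0.
have := rdot_jm v v (Ordinal kn); rewrite vJ rdotZl rdotZr /=.
move/mulIf => H; apply/CrealP; rewrite -H //.
by apply: contraNneq v0 => /rdotvv_eq0->.
Qed.

Lemma jm_orthogonal v1 v2 k a b : b \is Num.real -> a != b ->
  v1 *m jm_mx C k = a *: v1 -> v2 *m jm_mx C k = b *: v2 -> rdot v1 v2 = 0.
Proof.
move=> /CrealP br ab E1 E2; have := rdot_jm v1 v2 k.
rewrite E1 E2 rdotZl rdotZr br => /eqP.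
by rewrite -subr_eq0 -mulrBl mulf_eq0 subr_eq0 (negbTE ab) => /eqP.
Qed.

(** The first Jucys-Murphy element is an empty sum. *)
Lemma jm_spec_head x s : jm_spec (x :: s) -> x = 0.
Proof.
case=> /= ss [v v0 vJ]; have n0 : (0 < n)%N by rewrite -ss.
have /esym/eqP := vJ (Ordinal n0); rewrite /= /jm_mx big1 ?mulmx0 => [|i].
  by rewrite scaler_eq0 (negbTE v0) orbF => /eqP.
by rewrite ltn0.
Qed.

Section Adjacent.

Variables (i j : 'I_n) (ji : j = i.+1 :> nat) (v : 'rV[C]_N) (x y : C).
Hypotheses (v0 : v != 0) (xr : x \is Num.real) (yr : y \is Num.real).
Hypotheses (vi : v *m jm_mx C i = x *: v) (vj : v *m jm_mx C j = y *: v).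

Local Notation S := (lreg_mx C (tperm i j)).

(** Together with [adj_mxj], this makes the span of v and v S stable under J_i and J_j. *)
Lemma adj_mxi : v *m S *m jm_mx C i = y *: (v *m S) - v.
Proof.
have := jm_mxS C ji => /(congr1 (mulmx v)) /(congr1 (mulmxr S)) /=.
rewrite vj -scalemxAl => ->; rewrite mulmxDr mulmxDl -!mulmxA lreg_mx_tpermK.
by rewrite !mulmx1 addrK.
Qed.

Lemma adj_mxj : v *m S *m jm_mx C j = x *: (v *m S) + v.
Proof.
rewrite (jm_mxS C ji) mulmxDr !mulmxA -(mulmxA v) lreg_mx_tpermK mulmx1.
by rewrite vi -scalemxAl.
Qed.

(** If x = y, pairing v S J_j = x v S + v with v and using that J_j is self-adjoint leaves <v, v> =
    0. *)
Lemma adj_neq : x != y.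
Proof.
apply: contraNneq v0 => xy; apply/eqP/rdotvv_eq0.
have := rdot_jm (v *m S) v j; rewrite adj_mxj vj rdotDl rdotZl rdotZr.
by move/CrealP: yr => ->; rewrite xy -{2}[y * _]addr0 => /addrI.
Qed.

(** The multiple of v is chosen so that u satisfies the eigenvector equations of J_i and J_j with x
    and y exchanged. *)
Let u := v *m S - (y - x)^-1 *: v.

Lemma adj_intertwiner_i : u *m jm_mx C i = y *: u.
Proof.
have yx : y - x != 0 by rewrite subr_eq0 eq_sym adj_neq.
rewrite mulmxBl adj_mxi -scalemxAl vi scalerBr -addrA; congr (_ + _).
rewrite !scalerA -opprD -{1}[v]scale1r -scalerDl; congr (- (_ *: _)).
by field.
Qed.

Lemma adj_intertwiner_j : u *m jm_mx C j = x *: u.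
Proof.
have yx : y - x != 0 by rewrite subr_eq0 eq_sym adj_neq.
rewrite mulmxBl adj_mxj -scalemxAl vj scalerBr -addrA; congr (_ + _).
rewrite !scalerA -{1}[v]scale1r -!scaleNr -scalerDl; congr (_ *: _).
by field.
Qed.

(** If u = 0, then S scales v by the inverse of y - x, and S^2 = 1 forces (y - x)^2 = 1. *)
Lemma adj_intertwiner_neq0 : (y - x) ^+ 2 != 1 -> u != 0.
Proof.
have yx : y - x != 0 by rewrite subr_eq0 eq_sym adj_neq.
apply: contraNneq => /eqP; rewrite subr_eq0 => /eqP uE.
have := congr1 (mulmxr S) uE; rewrite /= -mulmxA lreg_mx_tpermK mulmx1.
rewrite -scalemxAl uE scalerA => /eqP.
rewrite -{1}[v]scale1r -subr_eq0 -scalerBl scaler_eq0 (negbTE v0) orbF subr_eq0.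
by rewrite -invfM -expr2 eq_sym invr_eq1.
Qed.

(* The intertwiner u is orthogonal to v and satisfies u S = - (y - x) u, so
   <u, u> = <u, v S> = <u S, v> = 0. *)
Lemma adj_scale : (y - x) ^+ 2 = 1 -> v *m S = (y - x) *: v.
Proof.
set e := y - x => e1.
have eV : e^-1 = e by apply: (mulfI (x := e)); rewrite -?expr2 ?e1 ?mulfV //;
  apply: contra_eq_neq e1 => ->; rewrite expr0n /= eq_sym oner_eq0.
have uv : rdot u v = 0.
  by apply: (jm_orthogonal xr _ adj_intertwiner_i vi); rewrite eq_sym adj_neq.
have uS : u *m S = - e *: u.
  rewrite /u mulmxBl -mulmxA lreg_mx_tpermK mulmx1 -scalemxAl -/e eV.
  by rewrite scalerBr scalerA !mulNr -expr2 e1 !scaleNr scale1r opprK addrC.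
have uE : v *m S - e *: v = u by rewrite /u -/e eV.
apply/eqP; rewrite -subr_eq0; apply/eqP/rdotvv_eq0; rewrite uE.
rewrite {1}/u rdotDl -scaleNr rdotZl (rdotC v) uv rmorph0 mulr0 addr0.
by rewrite rdot_lreg tpermV uS rdotZr (rdotC v) uv rmorph0 mulr0.
Qed.

End Adjacent.

Lemma jm_spec_adj s1 x y s2 : jm_spec (s1 ++ x :: y :: s2) ->
  exists i j : 'I_n, [/\ i = size s1 :> nat, j = i.+1 :> nat,
    x \is Num.real, y \is Num.real &
    exists2 v : 'rV[C]_N, v != 0 & [/\ v *m jm_mx C i = x *: v, v *m jm_mx C j = y *: v &
      forall k : 'I_n, v *m jm_mx C k = (s1 ++ x :: y :: s2)`_k *: v]].
Proof.
move=> sp; have [ss [v v0 vJ]] := sp.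
have jn : ((size s1).+1 < n)%N by rewrite -ss size_cat /=; lia.
exists (Ordinal (ltnW jn)), (Ordinal jn).
have Ex : (s1 ++ x :: y :: s2)`_(size s1) = x by rewrite nth_cat ltnn subnn.
have Ey : (s1 ++ x :: y :: s2)`_(size s1).+1 = y.
  by rewrite nth_cat ltnNge leqnSn subSnn.
split=> //; first by rewrite -Ex; apply: jm_spec_real.
  by rewrite -Ey; apply: jm_spec_real.
by exists v => //; split=> //; rewrite vJ /= ?Ex ?Ey.
Qed.

Lemma jm_spec_neq s1 x y s2 : jm_spec (s1 ++ x :: y :: s2) -> x != y.
Proof.
by case/jm_spec_adj => i [j [_ ji xr yr [v v0 [vi vj _]]]]; apply: (adj_neq ji v0).
Qed.

(** The intertwiner is the new eigenvector. Any other J_k commutes with the transposition (i j): for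
    k < i it fixes all indices up to k, and for k > j it permutes those below k. *)
Lemma jm_spec_swap s1 x y s2 : jm_spec (s1 ++ x :: y :: s2) ->
  (y - x) ^+ 2 != 1 -> jm_spec (s1 ++ y :: x :: s2).
Proof.
move=> sp yx; have [ss _] := sp; split; first by rewrite -ss !size_cat.
have [i [j [isz ji xr yr [v v0 [vi vj vJ]]]]] := jm_spec_adj sp.
exists (v *m lreg_mx C (tperm i j) - (y - x)^-1 *: v).
  exact: adj_intertwiner_neq0.
move=> k; case: (ltngtP k i) => ki.
- have Ek : (s1 ++ y :: x :: s2)`_k = (s1 ++ x :: y :: s2)`_k.
    by rewrite !nth_cat -isz ki.
  rewrite Ek mulmxBl -scalemxAl vJ -mulmxA comm_lreg_jm.
  + by rewrite mulmxA vJ -scalemxAl scalerBr !scalerA mulrC.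
  + by rewrite tpermD // -val_eqE /=; lia.
  + by move=> a ak; rewrite tpermD // -val_eqE /=; lia.
- have [kj|kj] := eqVneq k j.
    rewrite kj (adj_intertwiner_j ji v0) //; congr (_ *: _).
    by rewrite ji isz nth_cat ltnNge leqnSn subSnn.
  have kj' : (j < k)%N by move: kj; rewrite -val_eqE /=; lia.
  have Ek : (s1 ++ y :: x :: s2)`_k = (s1 ++ x :: y :: s2)`_k.
    rewrite !nth_cat -isz; have [l ->] : exists l, k = (i + l.+2)%N :> nat.
      by exists (k - i - 2)%N; lia.
    by rewrite ifN ?ifN ?addKn //; lia.
  rewrite Ek mulmxBl -scalemxAl vJ -mulmxA comm_lreg_jm.
  + by rewrite mulmxA vJ -scalemxAl scalerBr !scalerA mulrC.
  + by rewrite tpermD // -val_eqE /=; lia.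
  + by move=> a ak; case: tpermP => // _; lia.
- rewrite (val_inj ki) (adj_intertwiner_i ji v0) //; congr (_ *: _).
  by rewrite isz nth_cat ltnn subnn.
Qed.

(** If e = y - x were 1 or -1, the two adjacent transpositions would scale v by e and -e, and the
    braid relation would give -e^3 = e^3. *)
Lemma jm_spec_braid s1 x y s2 : jm_spec (s1 ++ x :: y :: x :: s2) ->
  (y - x) ^+ 2 != 1.
Proof.
move=> sp; apply/negP => /eqP e1.
have [i [j [isz ji xr yr [v v0 [vi vj vJ]]]]] := jm_spec_adj sp.
have kn : (j.+1 < n)%N.
  by have [ss _] := sp; rewrite -[ltnRHS]ss size_cat /= ji isz; lia.
pose k := Ordinal kn.
have vk : v *m jm_mx C k = x *: v.
  rewrite vJ /= ji isz nth_cat ifN; last by lia.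
  by congr (_ *: _); rewrite -addn2 addKn.
have e1' : (x - y) ^+ 2 = 1 by rewrite -e1; ring.
have E1 := adj_scale ji v0 xr yr vi vj e1.
have E2 := adj_scale (i := j) (j := k) (erefl _) v0 yr xr vj vk e1'.
have braid : (tperm i j * tperm j k * tperm i j = tperm j k * tperm i j * tperm j k)%g.
  have nij : i != j by rewrite -val_eqE /=; lia.
  have nik : i != k by rewrite -val_eqE /=; lia.
  have nkj : k != j by rewrite -val_eqE /=; lia.
  have := tpermJ_tperm nij (z := j); have := tpermJ j k (tperm i j).
  have := tpermJ i j (tperm j k).
  rewrite !conjgE !tpermV !mulgA => -> ->.
  by rewrite !(tpermL, tpermR) ![tperm _ k _]tpermD ?tpermD // eq_sym.
have := congr1 (fun g => v *m lreg_mx C g) braid.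
rewrite /= -!lreg_mxM !mulmxA; do !rewrite (E1, E2) -?scalemxAl.
rewrite !scalerA => /eqP; rewrite -subr_eq0 -scalerBl scaler_eq0 (negbTE v0) orbF.
have -> : (y - x) * (x - y) * (y - x) - (x - y) * (y - x) * (x - y) =
  - (2%:R * (y - x) * (y - x) ^+ 2) by ring.
rewrite e1 mulr1 oppr_eq0 mulf_eq0 pnatr_eq0 /= => /eqP yx.
by move: e1; rewrite yx expr0n => /esym/eqP; rewrite oner_eq0.
Qed.

End JointSpectrum.

(** * Patterns forced in a joint weight *)

Section ContentSequences.

Variables (n : nat) (C : numClosedFieldType).
Implicit Types (a x y e : C) (s m : seq C).
Local Notation jm_spec := (@jm_spec n C).

Lemma jm_spec_movel s1 m a s2 : jm_spec (s1 ++ m ++ a :: s2) ->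
  (forall x, x \in m -> (a - x) ^+ 2 != 1) -> jm_spec (s1 ++ a :: m ++ s2).
Proof.
elim/last_ind: m s2 => [//|m x IH] s2; rewrite !cat_rcons => sp mP.
apply: IH => [|y ym]; last by rewrite mP // mem_rcons inE ym orbT.
rewrite catA; apply: jm_spec_swap; first by rewrite -catA.
by rewrite mP // mem_rcons mem_head.
Qed.

Lemma jm_spec_mover s1 m a s2 : jm_spec (s1 ++ a :: m ++ s2) ->
  (forall x, x \in m -> (a - x) ^+ 2 != 1) -> jm_spec (s1 ++ m ++ a :: s2).
Proof.
elim: m s1 => [//|x m IH] s1 /= sp mP; rewrite -cat_rcons; apply: IH => [|y ym].
  rewrite cat_rcons; apply: jm_spec_swap sp _.
  by rewrite -(opprB a x) sqrrN mP // mem_head.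
by rewrite mP // inE ym orbT.
Qed.

(* In a shortest counterexample, a does not occur in m and a - e occurs at most
   once, so exchanges bring the two a's next to each other or to both sides of
   that a - e. *)
Lemma jm_spec_between s1 m a s2 e :
  jm_spec (s1 ++ a :: m ++ a :: s2) -> e ^+ 2 = 1 -> a + e \in m.
Proof.
have [k] := ubnP (size m); elim: k s1 m a s2 e => // k IH s1 m a s2 e mk sp e1.
apply/negPn/negP => am.
have [a_m|a_m] := boolP (a \in m).
  case/splitPr: a_m am mk sp => m1 m2; rewrite mem_cat size_cat /= => am mk.
  rewrite -catA /= => /IH/(_ e1) H; case/norP: am; rewrite H //; lia.
(* Since e^2 = 1, the only values that a cannot be exchanged with are a + e and a - e. *)
have far (t : seq C) : {subset t <= m} -> a - e \notin t ->
    forall x, x \in t -> (a - x) ^+ 2 != 1.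
  move=> tm ae x xt; rewrite -e1 eqf_sqr; apply/norP; split.
    by apply: contraNneq ae => <-; rewrite opprB addrC subrK.
  by apply: contraNneq am => E; rewrite -[e]opprK -E opprB addrC subrK tm.
have [ae|ae] := boolP (a - e \in m); last first.
  have := jm_spec_movel (s1 := rcons s1 a) (m := m) (a := a) (s2 := s2).
  rewrite !cat_rcons => /(_ sp (far _ (fun _ => id) ae)) /jm_spec_neq.
  by rewrite eqxx.
case/splitPr: ae mk sp a_m far am => m1 m2; rewrite size_cat /= => mk sp a_m far am.
(* Two occurrences of a - e would enclose a shorter gap, which by induction contains (a - e) + e =
   a. *)
have ae1 : a - e \notin m1.
  apply/negP => ae1; case/splitPr: ae1 mk sp a_m {far am} => m3 m4.
  rewrite size_cat /= -!catA /= => mk sp.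
  rewrite !(mem_cat, inE); apply/negP; rewrite negbK.
  have -> : a \in m4; last by rewrite !orbT.
  rewrite -(subrK e a); apply: (IH (s1 ++ a :: m3) m4 _ (m2 ++ a :: s2)) => //.
    by lia.
  by move: sp; rewrite -!catA.
have ae2 : a - e \notin m2.
  apply/negP => ae2; case/splitPr: ae2 mk sp a_m {far am} => m3 m4.
  rewrite size_cat /= -!catA /= => mk sp.
  rewrite !(mem_cat, inE); apply/negP; rewrite negbK.
  have -> : a \in m3; last by rewrite !orbT.
  rewrite -(subrK e a); apply: (IH (s1 ++ a :: m1) m3 _ (m4 ++ a :: s2)) => //.
    by lia.
  by move: sp; rewrite -!catA.
have sp1 : jm_spec (s1 ++ m1 ++ a :: (a - e) :: m2 ++ a :: s2).
  apply: jm_spec_mover; first by move: sp; rewrite -!catA.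
  by apply: far => // x xm; rewrite mem_cat xm.
have /jm_spec_braid : jm_spec ((s1 ++ m1) ++ a :: (a - e) :: a :: m2 ++ s2).
  have := @jm_spec_movel (s1 ++ m1 ++ [:: a; a - e]) m2 a s2.
  rewrite -!catA /=; apply=> //.
  by apply: far => // x xm; rewrite mem_cat inE xm !orbT.
by rewrite addrAC subrr add0r sqrrN e1 eqxx.
Qed.

(** Otherwise a could be moved to the front, so a = 0; but [s1] starts with 0 as well, and between
    two zeros there is a 1. *)
Lemma jm_spec_prev s1 a s2 : jm_spec (s1 ++ a :: s2) -> s1 != [::] ->
  (a + 1 \in s1) || (a - 1 \in s1).
Proof.
move=> sp s1n; apply/norP => -[ap am].
have /jm_spec_head a0 : jm_spec (a :: s1 ++ s2).
  apply: (@jm_spec_movel [::]) => // x xs1; rewrite -(expr1n _ 2) eqf_sqr.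
  apply/norP; split; first by apply: contraNneq am => <-; rewrite opprB addrC subrK.
  by apply: contraNneq ap => E; rewrite -[1]opprK -E opprB addrC subrK.
case: s1 s1n sp ap {am} => // x t _ sp; have x0 := jm_spec_head sp.
move: sp; rewrite x0 a0 => sp.
by rewrite inE (@jm_spec_between [::] t 0 s2 1 sp) ?orbT // expr1n.
Qed.

End ContentSequences.

(** * Growth sequences *)

(* A tableau is encoded by the list of its boxes (row, column) in the order of
   their entries; every prefix of that list is then a Young diagram. *)
Definition growth (b : seq (nat * nat)) : Prop :=
  [/\ uniq b,
      forall r c, (r.+1, c) \in b -> (index (r, c) b < index (r.+1, c) b)%N &
      forall r c, (r, c.+1) \in b -> (index (r, c) b < index (r, c.+1) b)%N].

Definition content (F : pzRingType) (x : nat * nat) : F := x.2%:R - x.1%:R.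

Lemma split_last (T : Type) (p : pred T) (s : seq T) : has p s ->
  exists s1 x s2, [/\ s = s1 ++ x :: s2, p x & ~~ has p s2].
Proof.
elim: s => //= y s IH; have [/IH[s1 [x [s2 [-> px ps2]]]] _|ps] := boolP (has p s).
  by exists (y :: s1), x, s2.
by rewrite orbF => py; exists [::], y, s.
Qed.

Section Growth.

Implicit Types (b : seq (nat * nat)) (x y : nat * nat).

Lemma growth_index b r c r' c' : growth b -> (r, c) \in b ->
  (r' <= r)%N -> (c' <= c)%N -> (index (r', c') b <= index (r, c) b)%N.
Proof.
case=> _ gr gc rc /subnK rE /subnK cE; move: rc; rewrite -{}rE -{}cE.
(* An absent box has index [size b], so a box of strictly smaller index than some other one is
   present. *)
have mem_lt x y : (index x b < index y b)%N -> x \in b.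
  by rewrite -index_mem => /leq_trans; apply; apply: index_size.
elim: (r - r')%N => [|d IH].
  elim: (c - c')%N => [//|d IH] /gc H.
  by apply: leq_trans (ltnW H); apply: IH (mem_lt _ _ H).
by move=> /gr H; apply: leq_trans (ltnW H); apply: IH (mem_lt _ _ H).
Qed.

Lemma growth_mem b r c r' c' : growth b -> (r, c) \in b ->
  (r' <= r)%N -> (c' <= c)%N -> (r', c') \in b.
Proof.
move=> gb rc r'r c'c; rewrite -index_mem.
by apply: leq_ltn_trans (growth_index gb rc r'r c'c) _; rewrite index_mem.
Qed.

Lemma growth_before b1 b2 r c r' c' : growth (b1 ++ (r, c) :: b2) ->
  (r' <= r)%N -> (c' <= c)%N -> (r', c') != (r, c) -> (r', c') \in b1.
Proof.
move=> gb r'r c'c ne; have ub : uniq (b1 ++ (r, c) :: b2) by case: gb.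
have rc : (r, c) \in b1 ++ (r, c) :: b2 by rewrite mem_cat mem_head orbT.
have := growth_index gb rc r'r c'c; rewrite !index_cat /= eqxx.
have /negbTE-> : (r, c) \notin b1 by move: ub; rewrite cat_uniq /= negb_or; case/and3P=> _ /andP[].
by case: ifP => //; rewrite eq_sym (negbTE ne) addn0 addnS ltnNge leq_addr.
Qed.

Lemma growth_after b1 b2 r c r' c' : growth (b1 ++ (r, c) :: b2) ->
  (r', c') \in b2 -> (r < r')%N || (c < c')%N.
Proof.
move=> gb yb2; apply/negPn/negP; rewrite negb_or -!leqNgt => /andP[r'r c'c].
have ub : uniq (b1 ++ (r, c) :: b2) by case: gb.
have ne : (r', c') != (r, c).
  apply: contraTneq yb2 => ->; move: ub.
  by rewrite cat_uniq cons_uniq => /and3P[_ _ /andP[]].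
move: ub; rewrite cat_uniq => /and3P[_ /hasPn/(_ (r', c'))].
by rewrite inE yb2 orbT => /(_ isT); rewrite (growth_before gb).
Qed.

Lemma growth_rcons b x : growth b -> x \notin b ->
  (forall r, x.1 = r.+1 -> (r, x.2) \in b) ->
  (forall c, x.2 = c.+1 -> (x.1, c) \in b) -> growth (rcons b x).
Proof.
case=> ub gr gc xb xr xc.
have lt_rcons y z : y \in b -> ((z \in b) && (index y b < index z b)%N) || (z == x) ->
    (index y (rcons b x) < index z (rcons b x))%N.
  move=> yb; rewrite -cats1 !index_cat yb => /orP[/andP[-> //]|/eqP->].
  by rewrite (negbTE xb) /= eqxx addn0 index_mem.
have mem_lt y z : (index y b < index z b)%N -> y \in b.
  by rewrite -index_mem => /leq_trans; apply; apply: index_size.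
split=> [|r c|r c]; first by rewrite rcons_uniq xb.
  rewrite mem_rcons inE => /orP[/eqP xE|m]; apply: lt_rcons.
  - by rewrite -[c]/(r.+1, c).2 xE xr // -xE.
  - by rewrite xE eqxx orbT.
  - exact: mem_lt (gr _ _ m).
  - by rewrite m gr.
rewrite mem_rcons inE => /orP[/eqP xE|m]; apply: lt_rcons.
- by rewrite -[r]/(r, c.+1).1 xE xc // -xE.
- by rewrite xE eqxx orbT.
- exact: mem_lt (gc _ _ m).
- by rewrite m gc.
Qed.

End Growth.

(** * From joint weights to growth sequences *)

Section GrowthOfSpectrum.

Variables (n : nat) (C : numClosedFieldType).

Lemma eq_content_add (x y : nat * nat) (p q : nat) :
  (content C x + p%:R == content C y + q%:R) = (x.2 + y.1 + p == y.2 + x.1 + q)%N.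
Proof.
rewrite -(eqr_nat C) !natrD /content -subr_eq0 -[RHS]subr_eq0.
by congr (_ == 0); ring.
Qed.

(** The induction runs over prefixes, with [s2] completing them to length n. A content a met before
    is placed diagonally below the last box of content a; a new one extends the first row or the
    first column. *)
Lemma growth_of_jm_spec s1 s2 : @jm_spec n C (s1 ++ s2) ->
  exists2 b, growth b & map (content C) b = s1.
Proof.
elim/last_ind: s1 s2 => [|s a IH] s2; first by exists [::].
rewrite cat_rcons => sp; have [b gb bs] := IH _ sp.
have [s0|sn0] := eqVneq s [::].
  exists [:: (0, 0)%N]; first by apply: (@growth_rcons [::]) => //; split.
  by move: sp; rewrite s0 /= => /jm_spec_head ->; rewrite /content subrr.
suff [x [xb xr xc xa]] : exists x, [/\ x \notin b,
    forall r, x.1 = r.+1 -> (r, x.2) \in b,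
    forall c, x.2 = c.+1 -> (x.1, c) \in b & content C x = a].
  by exists (rcons b x); [apply: growth_rcons | rewrite map_rcons bs xa].
have [a_s|a_s] := boolP (a \in s).
  have /split_last[b1 [[r c] [b2 [bE /eqP aE ab2]]]] : has (fun x => content C x == a) b.
    by move: a_s; rewrite -bs => /mapP[x xb ->]; apply/hasP; exists x.
  have next e : e ^+ 2 = 1 -> exists2 y : nat * nat, y \in b2 & a + e = content C y.
    move=> e1; apply/mapP; apply: (@jm_spec_between n C (map (content C) b1) _ a s2) => //.
    by move: sp; rewrite -bs bE map_cat /= aE -catA.
  have sub2 y : y \in b2 -> y \in b by rewrite bE mem_cat inE => ->; rewrite !orbT.
  have [[rp cp] ypb /eqP] := next 1 (expr1n _ _).
  rewrite -aE -[1]/(1%:R) -[X in _ == X]addr0 -[0]/(0%:R) eq_content_add /= => /eqP yp.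
  have [|[rm cm] ymb /eqP] := next (-1); first by rewrite sqrrN expr1n.
  rewrite -aE subr_eq -[1]/(1%:R) -[X in X == _]addr0 -[0]/(0%:R) eq_content_add /= => /eqP ym.
  rewrite bE in gb.
  (* A later box of content a + 1 lies weakly below and to the right of (r, c + 1), one of content a
     - 1 weakly below and to the right of (r + 1, c). So both neighbours of (r + 1, c + 1) are
     present. *)
  have := growth_after gb ypb; have := growth_after gb ymb; rewrite -bE in gb => gm gp.
  have cE : content C (r.+1, c.+1) = a.
    by rewrite -aE /content -!natr1 /=; ring.
  exists (r.+1, c.+1); split; last by rewrite cE aE.
  - rewrite bE mem_cat inE; apply/negP => /orP[d1|/orP[/eqP[]|d2]].
    + case/splitPr: d1 bE => d1 d2 bE; rewrite bE -catA in gb.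
      have /(growth_after gb) : (r, c) \in d2 ++ (r, c) :: b2.
        by rewrite mem_cat mem_head orbT.
      by lia.
    + lia.
    + by move/hasPn/(_ _ d2): ab2; rewrite cE eqxx.
  - by move=> _ [<-]; apply: (growth_mem gb (sub2 _ ypb)) => /=; lia.
  - by move=> _ [<-]; apply: (growth_mem gb (sub2 _ ymb)) => /=; lia.
have b00 : (0, 0)%N \in b.
  case E: b bs gb => [|[r c] b'] bs' gb; first by rewrite -bs' eqxx in sn0.
  by apply: (growth_mem gb (mem_head _ _)).
have a_b r c : (r, c) \in b -> a != content C (r, c).
  by move=> rc; apply: contraNneq a_s => ->; rewrite -bs map_f.
have := jm_spec_prev sp sn0; rewrite -bs => /orP[] /mapP[[r c] rc].
  move=> /esym ac; have {}ac : a = content C (r, c) - 1 by rewrite ac addrK.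
  (* If c <= r, the new box extends the first column; otherwise (0, c - r - 1) would already be a
     box of content a. The case of a - 1 below is the transpose. *)
  have [cr|rc'] := leqP c r.
    have aE : content C ((r - c).+1, 0%N) = a.
      by rewrite ac /content /= -natr1 natrB //; ring.
    exists ((r - c).+1, 0%N); split=> //=.
      by apply/negP => /a_b; rewrite aE eqxx.
    by move=> _ [<-]; apply: (growth_mem gb rc); rewrite ?leq_subr.
  have : (0%N, (c - r.+1)%N) \in b by apply: (growth_mem gb rc); rewrite ?leq_subr.
  by move/a_b; rewrite ac /content /= natrB // -natr1 => /eqP[]; ring.
move=> /esym ac; have {}ac : a = content C (r, c) + 1 by rewrite ac subrK.
have [rc'|cr] := leqP r c.
  have aE : content C (0%N, (c - r).+1) = a.
    by rewrite ac /content /= -natr1 natrB //; ring.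
  exists (0%N, (c - r).+1); split=> //=.
    by apply/negP => /a_b; rewrite aE eqxx.
  by move=> _ [<-]; apply: (growth_mem gb rc); rewrite ?leq_subr.
have : ((r - c.+1)%N, 0%N) \in b by apply: (growth_mem gb rc); rewrite ?leq_subr.
by move/a_b; rewrite ac /content /= natrB // -natr1 => /eqP[]; ring.
Qed.

End GrowthOfSpectrum.

(** * Specht polynomials *)

Section SpechtDet.

Variables (n : nat) (rr cc : 'I_n -> nat).

(* Up to sign, the determinant of this matrix is the Specht polynomial, the
   product over all columns of the Vandermonde determinant of their entries. *)
Definition specht_mx (A : comNzRingType) (y : 'I_n -> A) : 'M[A]_n :=
  \matrix_(k, i) (if cc k == cc i then y k ^+ rr i else 0).

Definition specht (A : comNzRingType) (y : 'I_n -> A) : A := \det (specht_mx y).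

Definition col_card (c : nat) : nat := #|[pred k | cc k == c]|.

Lemma eq_specht (A : comNzRingType) (y y' : 'I_n -> A) :
  y =1 y' -> specht y = specht y'.
Proof.
by move=> yy; congr (\det _); apply/matrixP => k i; rewrite !mxE yy.
Qed.

Lemma specht_morph (A B : comNzRingType) (f : {rmorphism A -> B}) (y : 'I_n -> A) :
  f (specht y) = specht (f \o y).
Proof.
rewrite -det_map_mx; congr (\det _); apply/matrixP => k i; rewrite !mxE.
by case: ifP; rewrite ?rmorph0 ?rmorphXn.
Qed.

Lemma specht_alt (A : comNzRingType) (y : 'I_n -> A) (a b : 'I_n) :
  a != b -> cc a = cc b -> y a = y b -> specht y = 0.
Proof.
move=> ab cab yab; apply: (determinant_alternate ab) => i.
by rewrite !mxE cab yab.
Qed.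

Lemma specht_tperm (A : comNzRingType) (y : 'I_n -> A) (a b : 'I_n) :
  a != b -> cc a = cc b -> specht (y \o tperm a b) = - specht y.
Proof.
move=> ab cab.
have -> : specht (y \o tperm a b) = \det (row_perm (tperm a b) (specht_mx y)).
  congr (\det _); apply/matrixP => k i; rewrite !mxE /=.
  by have -> : cc (tperm a b k) = cc k by case: tpermP => [->|->|].
by rewrite row_permE det_mulmx det_perm odd_tperm ab /= expr1 mulN1r.
Qed.

Hypothesis rr_lt : forall i, (rr i < col_card (cc i))%N.

(** In the expansion along row p the cofactors are constants, and the nonzero entries are powers of
    exponent [rr i] below the height of the column of p. *)
Lemma size_specht (F : idomainType) (y : 'I_n -> {poly F}) p :
    (size (y p) <= 2)%N -> (forall i, i != p -> (size (y i) <= 1)%N) ->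
  (size (specht y) <= col_card (cc p))%N.
Proof.
move=> yp yi; rewrite /specht (expand_det_row _ p).
apply: leq_trans (size_sum _ _ _) _; apply/bigmax_leqP => i _.
rewrite mxE; case: eqP => [pi|_]; last by rewrite mul0r size_poly0.
have cof : (size (cofactor (specht_mx y) p i) <= 1)%N.
  rewrite /cofactor -signr_odd size_Msign /determinant.
  apply: leq_trans (size_sum _ _ _) _; apply/bigmax_leqP => s _.
  rewrite size_Msign; apply: leq_trans (size_poly_prod_leq _ _) _.
  rewrite leq_subLR addn1 ltnS -sum1_card; apply: leq_sum => k _.
  rewrite !mxE; case: ifP => _; last by rewrite size_poly0.
  apply: leq_trans (size_poly_exp_leq _ _) _; rewrite ltnS.
  have /yi : lift p k != p by rewrite eq_sym neq_lift.
  by case: size => [|[|m]].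
apply: leq_trans (size_polyMleq _ _) _.
have le_exp : (size (y p ^+ rr i) <= (rr i).+1)%N.
  apply: leq_trans (size_poly_exp_leq _ _) _.
  by rewrite ltnS -[leqRHS]mul1n leq_mul2r -subn1 leq_subLR addn1 yp orbT.
rewrite -subn1 leq_subLR; apply: leq_trans (leq_add le_exp cof) _.
by rewrite addn1 add1n ltnS pi rr_lt.
Qed.

(* Both sides are polynomials in [y k] of degree less than the height of
   column [c'], and they agree when [y k] is one of the values in that column. *)
Lemma specht_garnir (F : fieldType) (y : 'I_n -> F) (k : 'I_n) c' :
    injective y -> c' != cc k -> (col_card (cc k) <= col_card c')%N ->
  \sum_(m | cc m == c') specht (y \o tperm m k) = specht y.
Proof.
move=> yinj ck le_col.
(* [Y] puts an indeterminate in place of the value at k, and [Z x] specialises it to x. *)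
pose Y i := if i == k then 'X else (y i)%:P.
pose P := \sum_(m | cc m == c') specht (Y \o tperm m k) - specht Y.
pose Z x i := if i == k then x else y i.
have PE x : P.[x] = \sum_(m | cc m == c') specht (Z x \o tperm m k) - specht (Z x).
  have YE j : (Y j).[x] = Z x j.
    by rewrite /Y /Z; case: eqP => _; rewrite (hornerX, hornerC).
  rewrite hornerD hornerN horner_sum; congr (_ - _).
    apply: eq_bigr => m _; rewrite -[LHS]/(horner_eval x _) specht_morph.
    by apply: eq_specht => j; apply: YE.
  rewrite -[LHS]/(horner_eval x _) specht_morph.
  by apply: eq_specht => j; apply: YE.
have P0 : P = 0.
  pose rs := [seq y m | m <- enum [pred m | cc m == c']].
  apply: (@roots_geq_poly_eq0 _ _ rs).
  - apply/allP => _ /mapP[m' m'c ->]; rewrite mem_enum inE in m'c.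
    have km : k != m' by apply: contra_neq ck => ->; rewrite (eqP m'c).
    (* At the value y m', the summand of m' exchanges two equal values and so cancels against the
       last term; in any other summand m and m' carry equal values within one column, so it
       vanishes. *)
    rewrite /root PE (bigD1 m') //= big1 ?addr0 => [|m /andP[mc mm']].
      rewrite subr_eq0; apply/eqP/eq_specht => j /=; rewrite /Z.
      case: tpermP => [->|->|//]; rewrite ?eqxx; first by rewrite eq_sym (negbTE km).
      by rewrite eq_sym (negbTE km).
    apply: (@specht_alt _ _ m m') => //; first by rewrite (eqP mc) (eqP m'c).
    rewrite /= tpermL (tpermD mm') // /Z eqxx eq_sym (negbTE km) //.
  - by rewrite map_inj_uniq // enum_uniq.
  rewrite size_map -cardE; apply: leq_trans (size_polyD _ _) _.
  have sY i : (size (Y i) <= (i == k).+1)%N.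
    by rewrite /Y; case: eqP => _; rewrite ?size_polyX ?size_polyC ?leq_b1.
  rewrite geq_max size_polyN; apply/andP; split.
    (* In the summand of m the indeterminate sits at m, in column c'; in the last term it sits at k,
       whose column is no taller. *)
    apply: leq_trans (size_sum _ _ _) _; apply/bigmax_leqP => m mc.
    rewrite -[#|_|]/(col_card c') -(eqP mc); apply: size_specht => [|i im] /=.
      by rewrite tpermL; apply: leq_trans (sY _) _; rewrite eqxx.
    apply: leq_trans (sY _) _; rewrite ltnS leqn0 eqb0.
    by rewrite -[X in _ != X](tpermL m k) (inj_eq perm_inj).
  apply: leq_trans le_col; apply: size_specht => [|i /negbTE ik].
    by apply: leq_trans (sY _) _; rewrite eqxx.
  by apply: leq_trans (sY _) _; rewrite ik.
have Zy : Z (y k) =1 y by move=> i; rewrite /Z; case: eqP => [->|].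
have := PE (y k); rewrite P0 horner0 => /esym/eqP.
rewrite subr_eq0 (eq_specht Zy) => /eqP <-.
by apply: eq_bigr => m _; apply: eq_specht => i /=; rewrite Zy.
Qed.

(** The entries of a kernel vector over one column are the coefficients of a polynomial of degree
    less than the column height that vanishes at all values in the column, hence is zero. *)
Lemma specht_neq0 (F : fieldType) (y : 'I_n -> F) : injective y ->
  (forall i j, cc i = cc j -> rr i = rr j -> i = j) -> specht y != 0.
Proof.
move=> yinj box_inj.
suff : row_free (specht_mx y)^T by rewrite row_free_unit unitmx_tr unitmxE unitfE.
rewrite -kermx_eq0; apply/eqP/row_matrixP => l; rewrite row0.
have : row l (kermx (specht_mx y)^T) *m (specht_mx y)^T = 0.
  by rewrite -row_mul mulmx_ker row0.
set u := row l _ => uM; apply/rowP => i0; rewrite [RHS]mxE.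
pose p := \sum_(i | cc i == cc i0) u 0 i *: 'X^(rr i).
have p0 : p = 0.
  apply: (@roots_geq_poly_eq0 _ _ [seq y k | k <- enum [pred k | cc k == cc i0]]).
  - apply/allP => _ /mapP[k kc ->]; rewrite mem_enum inE in kc.
    have := congr1 (fun M : 'rV_n => M 0 k) uM; rewrite !mxE => E; rewrite /root -E.
    rewrite /p horner_sum big_mkcond; apply/eqP/eq_bigr => i _.
    rewrite !mxE (eqP kc) eq_sym; case: ifP => _; last by rewrite mulr0.
    by rewrite hornerZ hornerXn.
  - by rewrite map_inj_uniq // enum_uniq.
  rewrite size_map -cardE; apply: leq_trans (size_sum _ _ _) _.
  apply/bigmax_leqP => i /eqP ic; apply: leq_trans (size_scale_leq _ _) _.
  by rewrite size_polyXn -[#|_|]/(col_card (cc i0)) -ic.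
have := congr1 (fun q : {poly F} => q`_(rr i0)) p0; rewrite coef0 coef_sum.
rewrite (bigD1 i0) //= coefZ coefXn eqxx mulr1 big1 ?addr0 // => i /andP[/eqP ic ii].
rewrite coefZ coefXn; case: eqP => [ri|_]; last by rewrite mulr0.
by rewrite (box_inj i i0 ic) ?eqxx // in ii.
Qed.

End SpechtDet.

(** * Column reading and the Specht eigenvector *)

Definition col_lt (x y : nat * nat) : bool :=
  (x.2 < y.2)%N || ((x.2 == y.2) && (x.1 < y.1)%N).

Lemma col_lt_trans : transitive col_lt.
Proof. by move=> y x z; rewrite /col_lt; lia. Qed.

Section ColumnReading.

Variables (b : seq (nat * nat)) (gb : growth b).

Let x0 := (0, 0)%N.
Local Notation n := (size b).
Let rr (k : 'I_n) := (nth x0 b k).1.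
Let cc (k : 'I_n) := (nth x0 b k).2.

Lemma card_boxes (P : pred (nat * nat)) :
  #|[pred k : 'I_n | P (nth x0 b k)]| = count P b.
Proof. by rewrite -sum1_card -sum1_count (big_nth x0) big_mkord. Qed.

Lemma box_in (k : 'I_n) : (rr k, cc k) \in b.
Proof. by rewrite -surjective_pairing mem_nth. Qed.

Lemma growth_height (k : 'I_n) : (rr k < col_card cc (cc k))%N.
Proof.
rewrite /col_card /cc (card_boxes (fun x => x.2 == _)) -/(cc k) -size_filter.
rewrite -(size_iota 0 (rr k).+1) -(size_map (fun r => (r, cc k))).
apply: uniq_leq_size; first by rewrite map_inj_uniq ?iota_uniq // => r r' [].
move=> x /mapP[r + ->]; rewrite mem_iota add0n ltnS => rk; rewrite mem_filter /= eqxx.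
exact: growth_mem (box_in k) _ _.
Qed.

(** The column of k, shifted left to column c, stays inside the diagram. *)
Lemma growth_height_antimono (k : 'I_n) c : (c <= cc k)%N ->
  (col_card cc (cc k) <= col_card cc c)%N.
Proof.
move=> ck; rewrite /col_card /cc !(card_boxes (fun x => x.2 == _)) -/(cc k) -!size_filter.
rewrite -(size_map (fun x => (x.1, c))); apply: uniq_leq_size.
  rewrite map_inj_in_uniq; first by rewrite filter_uniq //; case: gb.
  move=> [r d] [r' d']; rewrite !mem_filter /=.
  by move=> /andP[/eqP-> _] /andP[/eqP-> _] [->].
move=> x /mapP[[r d] + ->]; rewrite !mem_filter /= eqxx => /andP[/eqP-> rb].
exact: growth_mem rb _ _.
Qed.

Lemma growth_box_inj (i j : 'I_n) : cc i = cc j -> rr i = rr j -> i = j.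
Proof.
rewrite /cc /rr => cij rij; apply/val_inj/eqP => /=; have [ub _ _] := gb.
by rewrite -(nth_uniq x0 _ _ ub) // [nth _ _ i]surjective_pairing cij rij -surjective_pairing.
Qed.

Lemma sum_lt_fibers (V : nmodType) (I : finType) (f : I -> nat) (G : I -> V) m :
  \sum_(i | (f i < m)%N) G i = \sum_(c < m) \sum_(i | f i == c) G i.
Proof.
elim: m => [|m IH]; first by rewrite big_ord0 big_pred0.
rewrite big_ord_recr /= -IH (bigID (fun i => f i == m)) addrC /=.
by congr (_ + _); apply: eq_bigl => i; lia.
Qed.

Hypothesis sb : sorted col_lt b.

Lemma col_ltE (i k : 'I_n) :
  (i < k)%N = (cc i < cc k)%N || ((cc i == cc k) && (rr i < rr k)%N).
Proof.
rewrite -/(col_lt (nth x0 b i) (nth x0 b k)).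
have mono (j l : 'I_n) : (j < l)%N -> col_lt (nth x0 b j) (nth x0 b l).
  by move=> jl; apply: (sorted_ltn_nth col_lt_trans x0 sb) => //; apply: ltn_ord.
have irr x : col_lt x x = false by rewrite /col_lt; lia.
case: (ltngtP i k) => [/mono->//|/mono ki|/val_inj->]; last by rewrite irr.
by apply/esym/negP => ik; have := col_lt_trans ki ik; rewrite irr.
Qed.

Lemma card_above (k : 'I_n) :
  #|[pred i : 'I_n | (i < k)%N && (cc i == cc k)]| = rr k.
Proof.
transitivity #|[pred i : 'I_n | (cc i == cc k) && (rr i < rr k)%N]|.
  by apply: eq_card => i; rewrite !inE col_ltE; lia.
rewrite /rr /cc (card_boxes (fun x => (x.2 == _) && (x.1 < _)%N)) -size_filter.
rewrite -/(rr k) -/(cc k) -[RHS](size_iota 0) -[RHS](size_map (fun r => (r, cc k))).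
apply/perm_size/uniq_perm.
- by rewrite filter_uniq //; case: gb.
- by rewrite map_inj_uniq ?iota_uniq // => r r' [].
move=> [r c]; rewrite mem_filter /=; apply/idP/mapP => [/andP[/andP[/eqP-> rk] _]|].
  by exists r; rewrite // mem_iota.
move=> [r']; rewrite mem_iota /= add0n => rk [-> ->]; rewrite eqxx rk /=.
exact: growth_mem (box_in k) (ltnW rk) _.
Qed.

Lemma jm_spec_column_reading (C : numClosedFieldType) :
  @jm_spec n C (map (content C) b).
Proof.
split; first by rewrite size_map.
(* The eigenvector is the value of the Specht polynomial at the point (g 0, ..., g (n - 1)), as a
   function of g; translation by a transposition permutes the variables. *)
pose y (g : 'S_n) (j : 'I_n) : C := (g j : nat)%:R.
have yinj g : injective (y g).
  by move=> i j /eqP; rewrite eqr_nat => /eqP /val_inj /perm_inj.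
have yM t g : y (t * g)%g =1 y g \o t by move=> j; rewrite /y permM.
exists (\row_a specht rr cc (y (enum_val a))).
  apply/eqP => /rowP/(_ (enum_rank 1%g)); rewrite !mxE enum_rankK => /eqP.
  by apply/negP/specht_neq0 => //; [apply: growth_height | apply: growth_box_inj].
move=> k; apply/rowP => a; set g := enum_val a : 'S_n.
rewrite /jm_mx mulmx_sumr summxE.
have E (i : 'I_n) :
    ((\row_a specht rr cc (y (enum_val a))) *m lreg_mx C (tperm i k)) 0 a =
    specht rr cc (y g \o tperm i k).
  by rewrite lreg_mxE mxE enum_rankK; apply: eq_specht => j; rewrite yM.
under eq_bigr => i _ do rewrite E.
rewrite (bigID (fun i => cc i == cc k)) /= !mxE -/g.
have -> : \sum_(i < n | (i < k)%N && (cc i == cc k)) specht rr cc (y g \o tperm i k) =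
    - (rr k)%:R * specht rr cc (y g).
  rewrite (eq_bigr (fun _ => - specht rr cc (y g))) => [|i /andP[ik /eqP cik]].
    by rewrite sumr_const card_above mulNr mulr_natl mulNrn.
  by rewrite specht_tperm // -val_eqE /= ltn_eqF.
have -> : \sum_(i < n | (i < k)%N && (cc i != cc k)) specht rr cc (y g \o tperm i k) =
    (cc k)%:R * specht rr cc (y g).
  (* In column reading all boxes of the columns to the left precede k, so the sum runs over whole
     columns, as [specht_garnir] requires. *)
  rewrite (eq_bigl (fun i => (cc i < cc k)%N)) => [|i]; last by rewrite col_ltE; lia.
  rewrite sum_lt_fibers (eq_bigr (fun _ => specht rr cc (y g))) => [|c _].
    by rewrite sumr_const card_ord mulr_natl.
  apply: specht_garnir => //; first exact: growth_height.
    by rewrite ltn_eqF.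
  exact/growth_height_antimono/ltnW.
by rewrite -mulrDl (nth_map x0) // /content addrC.
Qed.

End ColumnReading.

(** * From growth sequences to joint weights *)

Section SpectrumOfGrowth.

Fixpoint inversions (b : seq (nat * nat)) : nat :=
  if b is x :: b' then (count (col_lt^~ x) b' + inversions b')%N else 0%N.

Lemma inversions_swap b1 x y b2 : col_lt y x ->
  (inversions (b1 ++ y :: x :: b2) < inversions (b1 ++ x :: y :: b2))%N.
Proof.
move=> yx; elim: b1 => [|z b1 IH] /=.
  have -> : col_lt x y = false by move: yx; rewrite /col_lt; lia.
  by rewrite yx; lia.
by rewrite !count_cat /=; lia.
Qed.

Lemma not_sorted_adj (T : Type) (e : rel T) (s : seq T) : ~~ sorted e s ->
  exists s1 x y s2, s = s1 ++ x :: y :: s2 /\ ~~ e x y.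
Proof.
elim: s => // x [//|y s] IH /=; rewrite negb_and => /orP[exy|/IH].
  by exists [::], x, y, s.
by move=> [s1 [x' [y' [s2 [-> exy]]]]]; exists (x :: s1), x', y', s2.
Qed.

Lemma growth_swap b1 x y b2 : growth (b1 ++ x :: y :: b2) ->
    y != (x.1.+1, x.2) -> y != (x.1, x.2.+1) ->
  growth (b1 ++ y :: x :: b2).
Proof.
case=> ub gr gc yr yc.
have pE : perm_eq (b1 ++ y :: x :: b2) (b1 ++ x :: y :: b2).
  by rewrite perm_cat2l (perm_catCA [:: y] [:: x]).
have xy : x == y = false.
  by move: ub; rewrite cat_uniq /= inE; case: eqP; rewrite ?andbF.
have swap_index u v : (index u (b1 ++ x :: y :: b2) < index v (b1 ++ x :: y :: b2))%N ->
    ~~ ((x == u) && (y == v)) ->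
  (index u (b1 ++ y :: x :: b2) < index v (b1 ++ y :: x :: b2))%N.
  rewrite !index_cat; case u1: (u \in b1); case v1: (v \in b1) => //=.
  - by move=> _ _; rewrite ltn_addr // index_mem.
  - move=> H; have := leq_trans H (index_size _ _).
    by rewrite ltnNge leq_addr.
  have nxy : x <> y by apply/eqP; rewrite xy.
  rewrite !ltn_add2l.
  by case: (eqVneq x u) => [xu|_]; case: (eqVneq y u) => [yu|_];
     case: (eqVneq x v) => [xv|_]; case: (eqVneq y v) => [yv|_] //=;
     case: nxy; congruence.
split; first by rewrite (perm_uniq pE).
  move=> r c; rewrite (perm_mem pE) => /gr /swap_index; apply.
  by apply: contra yr => /andP[/eqP-> /eqP->].
move=> r c; rewrite (perm_mem pE) => /gc /swap_index; apply.
by apply: contra yc => /andP[/eqP-> /eqP->].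
Qed.

(** Induction on the inversions with respect to column reading. Of two consecutive boxes in the
    wrong order, the second lies strictly below and to the left of the first, so their contents
    differ by at least 2 and the exchange is admissible. *)
Lemma jm_spec_growth (C : numClosedFieldType) b : growth b ->
  @jm_spec (size b) C (map (content C) b).
Proof.
have [k] := ubnP (inversions b); elim: k b => // k IH b bk gb.
have [sb|/not_sorted_adj] := boolP (sorted col_lt b).
  exact: jm_spec_column_reading.
move=> [b1 [[r c] [[r' c'] [b2 [bE nlt]]]]]; rewrite {}bE in bk gb *.
have ub : uniq (b1 ++ (r, c) :: (r', c') :: b2) by case: gb.
have ne : (r', c') != (r, c).
  by move: ub; rewrite cat_uniq /= inE eq_sym; case: eqP; rewrite ?andbF.
have lt : col_lt (r', c') (r, c).
  by move: ne nlt; rewrite /col_lt xpair_eqE /=; lia.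
have := growth_after gb (mem_head _ _) => after.
have [rr' c'c] : (r < r')%N /\ (c' < c)%N by move: lt; rewrite /col_lt /=; lia.
have gb' : growth (b1 ++ (r', c') :: (r, c) :: b2).
  by apply: growth_swap gb _ _; rewrite xpair_eqE /=; lia.
have := IH _ (leq_trans (inversions_swap _ _ lt) bk) gb'.
rewrite !map_cat /= !size_cat /= => /jm_spec_swap; apply.
have -> : content C (r, c) - content C (r', c') = ((c + r') - (c' + r))%N%:R.
  by rewrite natrB ?natrD /content /=; [ring | lia].
rewrite -natrX -[1]/(1%:R) eqr_nat; nia.
Qed.

End SpectrumOfGrowth.

(** * Tableaux and growth sequences *)

Section Tableaux.

Implicit Types (T : seq (seq nat)) (b : seq (nat * nat)).

Definition tab_boxes T : seq (nat * nat) :=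
  [seq (i, j) | i <- iota 0 (size T), j <- iota 0 (size (tab_row T i))].

Lemma mem_tab_boxes T i j : ((i, j) \in tab_boxes T) = (j < size (tab_row T i))%N.
Proof.
apply/allpairsPdep/idP => [[i' [j' [_ +]]]|ji].
  by rewrite mem_iota add0n => /andP[_ +] [-> ->].
exists i, j; rewrite !mem_iota; split=> //=; rewrite add0n ltnNge.
by apply: contraTN ji => Ti; rewrite /tab_row nth_default.
Qed.

Lemma tab_boxes_uniq T : uniq (tab_boxes T).
Proof.
apply: allpairs_uniq_dep => [|i _|[i j] [i' j'] _ _ [-> ->] //]; exact: iota_uniq.
Qed.

Lemma flatten_tab T : flatten T = [seq tab_entry T x.1 x.2 | x <- tab_boxes T].
Proof.
rewrite /tab_boxes map_allpairs /= -[in LHS](mkseq_nth [::] T); congr flatten.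
by apply: eq_map => i; rewrite -[LHS](mkseq_nth 0%N).
Qed.

Lemma sum_tab_boxes (V : nmodType) T (G : nat -> nat -> V) :
  \sum_(i < size T) \sum_(j < size (tab_row T i)) G i j =
  \sum_(x <- tab_boxes T) G x.1 x.2.
Proof.
have iotaE m (H : nat -> V) : \sum_(i < m) H i = \sum_(i <- iota 0 m) H i.
  by rewrite -(big_mkord xpredT) /index_iota subn0.
rewrite /tab_boxes big_allpairs_dep /= -iotaE; apply: eq_bigr => i _.
exact: iotaE.
Qed.

(** The boxes are sorted by entry. As the entries are 1, ..., n, the index of a box is its entry
    minus one, and increase along rows and columns becomes the growth condition. *)
Lemma growth_of_tableau n (T : standard_tableau n) :
  exists2 b, growth b & perm_eq b (tab_boxes T) /\
    [seq tab_entry T x.1 x.2 | x <- b] = iota 1 n.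
Proof.
case: T => /= T /andP[shT _] contT rowT colT.
pose e (x : nat * nat) := tab_entry T x.1 x.2.
pose b := sort (relpre e leq) (tab_boxes T).
have bT : perm_eq b (tab_boxes T) by rewrite perm_sort.
have bE : map e b = iota 1 n.
  rewrite /b -sort_map; apply: (sorted_eq leq_trans anti_leq).
  - exact/sort_sorted/leq_total.
  - exact: iota_sorted.
  by rewrite perm_sort -flatten_tab.
have size_b : size b = n by rewrite -(size_map e) bE size_iota.
have index_b x : x \in b -> (index x b).+1 = e x.
  move=> xb; rewrite -[in RHS](nth_index (0, 0)%N xb) -(nth_map _ 0%N) ?index_mem //.
  by rewrite bE nth_iota // -size_b index_mem.
have memb i j : ((i, j) \in b) = (j < size (tab_row T i))%N.
  by rewrite (perm_mem bT) mem_tab_boxes.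
exists b => //; split; first by rewrite (perm_uniq bT) tab_boxes_uniq.
  move=> r c rcb; have rb : (r, c) \in b.
    move: rcb; rewrite !memb => rc; apply: leq_trans rc _.
    have [rT|rT] := ltnP r.+1 (size T); last by rewrite [tab_row T r.+1]nth_default.
    have/sortedP := shT => /(_ 0%N r); rewrite size_map => /(_ rT).
    by rewrite !(nth_map [::]) // ltnW.
  by rewrite -ltnS !index_b //; move: rcb; rewrite memb => /colT.
move=> r c rcb; have rb : (r, c) \in b.
  by move: rcb; rewrite !memb; apply: ltnW.
by rewrite -ltnS !index_b //; move: rcb; rewrite memb => /rowT.
Qed.

(** This identifies the columns met in a row of a diagram, and the rows met in its first column,
    with initial segments. *)
Lemma mem_lower_set (s : seq nat) j : uniq s ->
    (forall i k, k \in s -> (i <= k)%N -> i \in s) ->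
  (j \in s) = (j < size s)%N.
Proof.
move=> us low; apply/idP/idP => [js|].
  rewrite -(size_iota 0 j.+1); apply: uniq_leq_size (iota_uniq _ _) _ => i.
  by rewrite mem_iota ltnS => ij; apply: low js ij.
rewrite ltnNge; apply: contraNT => js; rewrite -[leqRHS](size_iota 0).
apply: uniq_leq_size us _ => k ks; rewrite mem_iota ltnNge.
by apply: contra js; apply: low.
Qed.

Lemma tableau_of_growth b : growth b ->
  exists T : standard_tableau (size b), perm_eq b (tab_boxes T) /\
    [seq tab_entry T x.1 x.2 | x <- b] = iota 1 (size b).
Proof.
move=> gb; have [ub gr gc] := gb.
(* Row lengths [rl], the number [nr] of rows, read off the first column, and entries [f], shifted by
   one because indices start at 0. *)
pose rl i := size [seq x <- b | x.1 == i].
pose nr := size [seq x <- b | x.2 == 0%N].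
pose f i j := (index (i, j) b).+1.
pose T := mkseq (fun i => mkseq (f i) (rl i)) nr.
have rlP i j : ((i, j) \in b) = (j < rl i)%N.
  rewrite /rl -(size_map snd) -mem_lower_set.
  - apply/idP/mapP => [ijb|[[i' j']]]; first by exists (i, j); rewrite ?mem_filter ?eqxx.
    by rewrite mem_filter /= => /andP[/eqP-> ijb] ->.
  - rewrite map_inj_in_uniq ?filter_uniq // => -[i1 j1] [i2 j2].
    by rewrite !mem_filter /= => /andP[/eqP-> _] /andP[/eqP-> _] ->.
  move=> k l /mapP[[i' j']]; rewrite mem_filter /= => /andP[/eqP-> ijb] -> kl.
  by apply/mapP; exists (i, k); rewrite // mem_filter /= eqxx (growth_mem gb ijb).
have nrP i : (0 < rl i)%N = (i < nr)%N.
  rewrite -rlP /nr -(size_map fst) -mem_lower_set.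
  - apply/idP/mapP => [ijb|[[i' j']]]; first by exists (i, 0%N); rewrite ?mem_filter ?eqxx.
    by rewrite mem_filter /= => /andP[/eqP-> ijb] ->.
  - rewrite map_inj_in_uniq ?filter_uniq // => -[i1 j1] [i2 j2].
    by rewrite !mem_filter /= => /andP[/eqP-> _] /andP[/eqP-> _] ->.
  move=> k l /mapP[[i' j']]; rewrite mem_filter /= => /andP[/eqP-> ijb] -> kl.
  by apply/mapP; exists (k, 0%N); rewrite // mem_filter /= (growth_mem gb ijb).
have rowE i : tab_row T i = mkseq (f i) (rl i).
  rewrite /tab_row; have [inr|] := ltnP i nr; first by rewrite nth_mkseq.
  move=> nri; rewrite nth_default ?size_mkseq //.
  by move: nri; rewrite leqNgt -nrP -eqn0Ngt => /eqP->.
have entryE i j : (j < rl i)%N -> tab_entry T i j = f i j.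
  by move=> ji; rewrite /tab_entry rowE nth_mkseq.
have bT : perm_eq b (tab_boxes T).
  apply: uniq_perm ub (tab_boxes_uniq T) _ => -[i j].
  by rewrite mem_tab_boxes rowE size_mkseq rlP.
have bE : [seq tab_entry T x.1 x.2 | x <- b] = iota 1 (size b).
  apply: (@eq_from_nth _ 0%N) => [|k]; first by rewrite size_map size_iota.
  rewrite size_map => kb; rewrite (nth_map (0, 0)%N) // nth_iota // add1n.
  case E: (nth _ b k) => [i j] /=; rewrite entryE /f; last by rewrite -rlP -E mem_nth.
  by rewrite -E index_uniq.
have shT : is_partition (map size T).
  apply/andP; split; last first.
    apply/mapP => -[t /mapP[k]]; rewrite mem_iota add0n /= -nrP => + ->.
    by rewrite size_mkseq => + rk; rewrite -rk.
  apply/(sortedP 0%N) => i; rewrite size_map size_mkseq => inr.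
  rewrite !(nth_map [::]) ?size_mkseq ?(ltnW inr) // !nth_mkseq ?(ltnW inr) // !size_mkseq.
  (* If row i + 1 were longer than row i, it would have a box in column [rl i], whose upper
     neighbour is missing. *)
  rewrite /= leqNgt; apply/negP => lt; have := gr i (rl i); rewrite !rlP lt => /(_ isT).
  by move/leq_trans/(_ (index_size _ _)); rewrite index_mem rlP ltnn.
have contT : perm_eq (flatten T) (iota 1 (size b)).
  by rewrite flatten_tab -bE perm_map // perm_sym.
have rowT i j : (j.+1 < size (tab_row T i))%N ->
    (tab_entry T i j < tab_entry T i j.+1)%N.
  by rewrite rowE size_mkseq => ji; rewrite !entryE ?(ltnW ji) // ltnS gc // rlP.
have colT i j : (j < size (tab_row T i.+1))%N ->
    (tab_entry T i j < tab_entry T i.+1 j)%N.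
  rewrite rowE size_mkseq -rlP => ji.
  have ij : (i, j) \in b by apply: growth_mem gb ji _ _.
  by rewrite !entryE -?rlP // ltnS gr.
by exists (StandardTableau shT contT rowT colT).
Qed.

End Tableaux.

(** * The shuffle *)

Section Shuffle.

Variables (R : realType) (w : nat -> R) (n : nat).

Local Notation coef k := (w k.+1 / weight_sum w n * (k.+1%:R)^-1).

(** The sum over the boxes is reordered by entry; position k of b holds the box with entry k + 1. *)
Lemma eig_boxes (T : standard_tableau n) (b : seq (nat * nat)) :
    perm_eq b (tab_boxes T) -> [seq tab_entry T x.1 x.2 | x <- b] = iota 1 n ->
  eig w T = \sum_(k < n) coef k * (1 + content R (nth (0, 0)%N b k)).
Proof.
move=> bT bE; have size_b : size b = n.
  by rewrite -(size_iota 1 n) -bE size_map.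
have /= := sum_tab_boxes T (fun i j =>
  (j%:R - i%:R + 1) / (tab_entry T i j)%:R * w (tab_entry T i j)).
rewrite /eig => ->; rewrite -(perm_big _ bT) /=.
rewrite (big_nth (0, 0)%N) size_b big_mkord mulr_sumr; apply: eq_bigr => k _.
have -> : tab_entry T (nth (0, 0)%N b k).1 (nth (0, 0)%N b k).2 = k.+1.
  by rewrite -(nth_map _ 0%N (fun x => tab_entry T x.1 x.2)) ?size_b // bE nth_iota.
by rewrite /content; ring.
Qed.

Lemma OST_mx_jm :
  map_mx (real_complex R) (OST_mx w n) =
  \sum_(k < n) (real_complex R (coef k)) *: (1%:M + jm_mx _ k).
Proof.
apply/matrixP => a b; rewrite mxE summxE mxE /OST rmorph_sum; apply: eq_bigr => j _.
(* A transposition t is its own inverse, so t = h g^-1 amounts to g = t h. *)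
have E i : (tperm i j == enum_val b * (enum_val a)^-1)%g =
    (enum_val a == tperm i j * enum_val b)%g.
  apply/eqP/eqP => [tE|->]; last by rewrite invMg mulKVg tpermV.
  by rewrite -[tperm i j]tpermV tE invMg invgK mulgKV.
(* The pair (j, j) yields the identity matrix, the pairs with i < j yield J_j. *)
rewrite rmorph_sum big_mkcondr (bigD1 j) //= !mxE mulrDr E tperm1 mul1g.
rewrite (inj_eq enum_val_inj); congr (_ + _).
  by case: eqP => _; rewrite ?mulr1 ?mulr0.
rewrite summxE mulr_sumr; apply: eq_big => [i|i _].
  by rewrite -val_eqE /=; lia.
by rewrite mxE E; case: eqP => _; rewrite ?mulr1 ?mulr0.
Qed.


End Shuffle.

(** The J_k stabilise the eigenspace of A and commute on it, so they have a common eigenvector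
    there. *)
Lemma eigenvalue_comm (C : numClosedFieldType) (m p : nat) (A : 'M[C]_m)
    (J : 'I_p -> 'M[C]_m) (z : C) :
    (forall k, comm_mx A (J k)) -> (forall k l, comm_mx (J k) (J l)) ->
  eigenvalue A z -> exists2 v : 'rV[C]_m, v != 0 /\ v *m A = z *: v &
    exists a : 'I_p -> C, forall k, v *m J k = a k *: v.
Proof.
move=> AJ JJ zA; set V := eigenspace A z.
have stabV k : stablemx V (J k) by apply: comm_mx_stable_eigenspace.
pose B k := restrictmx V (J k).
have [] := @common_eigenvector _ (\rank V) [seq B k | k : 'I_p].
- by rewrite lt0n mxrank_eq0.
- move=> _ _ /mapP[k _ ->] /mapP[l _ ->]; rewrite /comm_mx /B.
  by rewrite -!conjmxM ?inE ?stablemx_row_base // JJ.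
move=> u u0 /allP /= uB; exists (u *m row_base V).
  split; first by rewrite mulmx_free_eq0 ?row_base_free.
  by apply/eigenspaceP; rewrite -/V mulmx_sub // eq_row_base.
have uJ k : exists a, u *m row_base V *m J k = a *: (u *m row_base V).
  have : stablemx (u *m row_base V) (J k).
    rewrite -stablemx_restrict ?stabV // uB //; apply: map_f; exact: mem_enum.
  by move/eigenvectorP => [a /eigenspaceP]; exists a.
have [a aP] := fin_all_exists uJ; by exists a.
Qed.

Unset Implicit Arguments.

Local Open Scope complex_scope.

Theorem lemma3p6p5 (R : realType) (w : nat -> R)
    (hw : forall k : nat, (0 < k)%N -> 0 < w k) (n : nat) (z : R[i]) :
  eigenvalue (map_mx (real_complex R) (OST_mx w n)) z <->
  exists T : standard_tableau n, z = (eig w T)%:C.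
Proof.
pose C : numClosedFieldType := R[i].
have act (s : seq C) (v : 'rV[C]_#|{: 'S_n}|) :
    (forall k : 'I_n, v *m jm_mx C k = s`_k *: v) ->
    v *m map_mx (real_complex R) (OST_mx w n) =
    (\sum_(k < n) (w k.+1 / weight_sum w n / k.+1%:R)%:C * (1 + s`_k)) *: v.
  move=> vJ; rewrite OST_mx_jm mulmx_sumr scaler_suml; apply: eq_bigr => k _.
  by rewrite -scalemxAr mulmxDr mulmx1 vJ -{1}[v]scale1r -scalerDl scalerA.
have eigC (T : standard_tableau n) (b : seq (nat * nat)) :
    perm_eq b (tab_boxes T) -> [seq tab_entry T x.1 x.2 | x <- b] = iota 1 n ->
    \sum_(k < n) (w k.+1 / weight_sum w n / k.+1%:R)%:C * (1 + (map (content C) b)`_k) =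
    (eig w T)%:C.
  move=> bT bE; have size_b : size b = n by rewrite -(size_iota 1 n) -bE size_map.
  rewrite (eig_boxes w bT bE) rmorph_sum; apply: eq_bigr => k _.
  rewrite (nth_map (0, 0)%N) ?size_b // [RHS]rmorphM; congr (_ * _).
  by rewrite rmorphD rmorph1 rmorphB !rmorph_nat.
split=> [zA|[T ->]].
  have [k|k l|v [v0 vz] [a va]] := @eigenvalue_comm C _ n _ (@jm_mx n C) z _ _ zA.
  - rewrite /comm_mx OST_mx_jm mulmx_suml mulmx_sumr; apply: eq_bigr => j _.
    by rewrite -scalemxAl -scalemxAr mulmxDl mulmxDr mul1mx mulmx1 comm_jm.
  - exact: comm_jm.
  pose s := [seq a k | k : 'I_n].
  have vs k : v *m jm_mx C k = s`_k *: v.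
    by rewrite va /s (nth_map k) ?size_enum_ord // nth_ord_enum.
  (* The whole weight is taken as the prefix in [growth_of_jm_spec]. *)
  have sp : @jm_spec n C (s ++ [::]).
    by split; [rewrite cats0 size_map size_enum_ord | exists v; rewrite // cats0].
  have [b gb bs] := growth_of_jm_spec sp.
  have size_b : size b = n.
    by rewrite -(size_map (content C)) bs size_map size_enum_ord.
  have := tableau_of_growth gb; rewrite size_b => -[T [bT bE]]; exists T.
  (* Both z and the value of T are eigenvalues for the same nonzero vector v, so they agree. *)
  rewrite -(eigC T b bT bE) bs; have := act s v vs; rewrite vz => /eqP.
  by rewrite -subr_eq0 -scalerBl scaler_eq0 (negbTE v0) orbF subr_eq0 => /eqP.
have [b gb [bT bE]] := growth_of_tableau T.
have size_b : size b = n by rewrite -(size_iota 1 n) -bE size_map.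
have := @jm_spec_growth C b gb; rewrite size_b => -[_ [v v0 vJ]].
apply/eigenvalueP; exists v => //.
by rewrite (act _ v vJ) (eigC T b bT bE).
Qed.
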